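(* Let $f:\mathbb R_+^n\to\mathbb R_+$ be supermodular, twice continuously differentiable on the open orthant, and homogeneous of degree $k<1/2$. Then the function $\boldsymbol z\mapsto f(z_1^2,\dots,z_n^2)-\big(\sum_iz_i\big)^2$ is concave on $\mathbb R_+^n$, and $\Gamma^*=\max_{\boldsymbol a\ge0}\{f(\boldsymbol a)-(\sum_i\sqrt{a_{A_i}})^2\}$ equals its maximum over $\boldsymbol z\in\mathbb R_+^n$ (via $a_{A_i}=z_i^2$); hence the principal's optimization problem is a concave maximization problem.
   Context: Supermodular (for twice differentiable $f$): $\partial^2f/\partial a_i\partial a_j\ge0$ for all $i\neq j$. Homogeneous of degree $k$: $f(\lambda\boldsymbol a)=\lambda^kf(\boldsymbol a)$ for $\lambda>0$. In team production with costs $c_{A_i}(a_{A_i})=a_{A_i}$, $\Gamma^*$ denotes the maximal equilibrium potential under budget-balanced linear contracts, characterized as $\max_{\boldsymbol a\ge0}\{f(\boldsymbol a)-(\sum_i\sqrt{a_{A_i}})^2\}$.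
   Formalization: The formal statement additionally assumes f is continuous on the closed orthant; without this the claim fails, e.g. f=(a₁a₂)^{k/2} inside with f(a₁,0)=Ca₁^k, f(0,a₂)=Ca₂^k, C large, or f(a)=a^k with k<0 and f(0)=0. *)

(* Defs.v *)
From HB Require Import structures.
From mathcomp Require Import all_boot all_order all_algebra.
From mathcomp Require Import all_classical all_reals all_analysis.
Set Implicit Arguments. Unset Strict Implicit. Unset Printing Implicit Defensive.
Import Order.TTheory GRing.Theory Num.Theory.
Import numFieldNormedType.Exports.
Local Open Scope classical_set_scope.
Local Open Scope ring_scope.

Section Defs.
Context {R : realType} {n : nat}.

Definition nonneg_orthant : set 'rV[R]_n := [set a | forall i, 0 <= a ord0 i].
Definition pos_orthant : set 'rV[R]_n := [set a | forall i, 0 < a ord0 i].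

Definition ev (i : 'I_n) : 'rV[R]_n := delta_mx ord0 i.

Definition partial2 (f : 'rV[R]_n -> R) (i j : 'I_n) : 'rV[R]_n -> R :=
  'D_(ev j) ('D_(ev i) f).

Definition C2_on_pos_orthant (f : 'rV[R]_n -> R) : Prop :=
  forall a, pos_orthant a ->
    differentiable f a /\
    forall i, differentiable ('D_(ev i) f) a /\
      forall j, {for a, continuous (partial2 f i j)}.

Definition supermodular_C2 (f : 'rV[R]_n -> R) : Prop :=
  forall a, pos_orthant a -> forall i j, i != j -> 0 <= partial2 f i j a.

Definition homogeneous (f : 'rV[R]_n -> R) (k : R) : Prop :=
  forall (l : R) a, 0 < l -> nonneg_orthant a -> f (l *: a) = l `^ k * f a.

Definition principal_obj (f : 'rV[R]_n -> R) (a : 'rV[R]_n) : R :=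
  f a - (\sum_i Num.sqrt (a ord0 i)) ^+ 2.

Definition squared_obj (f : 'rV[R]_n -> R) (z : 'rV[R]_n) : R :=
  f (\row_i (z ord0 i) ^+ 2) - (\sum_i z ord0 i) ^+ 2.

Definition concave_on (A : set 'rV[R]_n) (g : 'rV[R]_n -> R) : Prop :=
  forall x y (t : R), A x -> A y -> 0 <= t <= 1 ->
    t * g x + (1 - t) * g y <= g (t *: x + (1 - t) *: y).
End Defs.

(* Main.v *)
Require Import Defs.
From HB Require Import structures.
From mathcomp Require Import all_boot all_order all_algebra.
From mathcomp Require Import all_classical all_reals all_analysis.
From mathcomp Require Import ring lra.
Set Implicit Arguments.
Unset Strict Implicit.
Unset Printing Implicit Defensive.
Import Order.TTheory GRing.Theory Num.Theory.
Import numFieldNormedType.Exports.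
Local Open Scope classical_set_scope.
Local Open Scope ring_scope.

(** Supermodularity makes the increments of [f] in direction [i] monotone in the
other coordinates; letting these tend to 0 and using homogeneity on the axis,
where [f] is [c * a ^ k] with [c >= 0], shows that [f] is nondecreasing. Along a
segment in [z], with [a = z ^ 2] and [u_i = v_i / z_i], the second derivative of
[f (z ^ 2)] is
  [\sum_i 2 u_i^2 a_i f_i + \sum_(i, j) 4 u_i u_j a_i a_j f_ij].
Bounding [2 u_i u_j] by [u_i^2 + u_j^2] off the diagonal, where [f_ij >= 0], and
applying Euler's identity to the first derivatives, it is at most
[(4 k - 2) \sum_i u_i^2 a_i f_i <= 0]. Concavity passes to the closed orthant by
continuity. With [T = \sum_i z_i >= 1], monotonicity gives
[f (z ^ 2) <= T ^ (2 k) f (1, ..., 1) <= T f (1, ..., 1)], so that the objective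
is at most 0 for large [T] and a maximiser exists by compactness. *)


(** * Calculus along curves and segments of the open orthant *)

Lemma is_derive_comp_differentiable (R : realType) (V W : normedModType R)
    (g : R -> V) (f : V -> W) (t : R) (dg : V) :
  is_derive t 1 g dg -> differentiable f (g t) ->
  is_derive t 1 (f \o g) ('D_dg f (g t)).
Proof.
move=> [/derivable1_diffP gt gE] fgt; have fg := differentiable_comp gt fgt.
apply: DeriveDef; first exact/derivable1_diffP.
by rewrite deriveE// diff_comp//= -gE !deriveE.
Qed.

Lemma derive_row_sum (R : realType) (n : nat) (W : normedModType R)
    (f : 'rV[R]_n -> W) (a v : 'rV[R]_n) : differentiable f a ->
  'D_v f a = \sum_i v ord0 i *: 'D_(ev i) f a.
Proof.
move=> fa; rewrite deriveE// [in LHS](row_sum_delta v) linear_sum/=.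
by apply: eq_bigr => i _; rewrite linearZ/= deriveE.
Qed.

Lemma is_derive_row (R : realType) (n : nat) (c dc : 'I_n -> R -> R) (t : R) :
  (forall i, is_derive t 1 (c i) (dc i t)) ->
  is_derive t 1 (fun s => \row_i c i s) (\row_i dc i t).
Proof.
move=> cd.
have dr : derivable (fun s => \row_i c i s) t 1.
  apply/derivable_mxP => i j; rewrite (_ : (fun _ => _) = c j).
    by have [] := cd j.
  by apply/funext => s; rewrite mxE.
apply: DeriveDef => //; rewrite derive_mx//; apply/rowP => j; rewrite !mxE.
rewrite (_ : (fun _ => _) = c j); first by have [] := cd j.
by apply/funext => s; rewrite mxE.
Qed.

Lemma is_derive_line (R : realType) (V : normedModType R) (x v : V) (t : R) :
  is_derive t 1 (fun s => s *: v + x) v.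
Proof.
apply: DeriveDef.
  by apply/derivable1_diffP.
rewrite deriveE//.
by rewrite diff_val /= fctE /= scale1r addr0.
Qed.

Lemma near_pos_orthant (R : realType) (n : nat) (a : 'rV[R]_n) :
  pos_orthant a -> \forall b \near a, pos_orthant b.
Proof.
move=> a0; rewrite /pos_orthant /=.
apply: (@filter_forall _ _ (fun i (b : 'rV[R]_n) => 0 < b ord0 i)
  (nbhs a) _) => i.
have : (fun b : 'rV[R]_n => b ord0 i) b @[b --> a] --> a ord0 i.
  exact: coord_continuous.
by move=> /cvgr_gt; apply.
Qed.

Lemma pos_orthant_segment (R : realType) (n : nat) (a b : 'rV[R]_n) (t : R) :
  pos_orthant a -> pos_orthant b -> 0 <= t <= 1 ->
  pos_orthant (t *: (b - a) + a).
Proof.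
move=> a0 b0 /andP[t0 t1] i; rewrite !mxE.
have := a0 i; have := b0 i; nra.
Qed.

(** Restricting [g] to the segment from [a] to [b], which stays in the open orthant, gives a
    one-variable function with derivative ['D_(b - a) g], nonnegative on [0, 1]. *)
Lemma ge0_derive_le (R : realType) (n : nat) (g : 'rV[R]_n -> R)
    (a b : 'rV[R]_n) :
  pos_orthant a -> pos_orthant b ->
  (forall p, pos_orthant p -> differentiable g p) ->
  (forall p, pos_orthant p -> 0 <= 'D_(b - a) g p) -> g a <= g b.
Proof.
move=> a0 b0 dg g0; pose h := g \o (fun s : R => s *: (b - a) + a).
have hd (t : R) : t \in `[0, 1] ->
    is_derive t (1 : R) h ('D_(b - a) g (t *: (b - a) + a)).
  move=> t01; apply: is_derive_comp_differentiable; first exact: is_derive_line.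
  by apply: dg; apply: pos_orthant_segment => //; rewrite in_itv in t01.
have := @ger0_derive1_le_cc R h 0 1.
have -> : g a = h 0 by rewrite /h /= scale0r add0r.
have -> : g b = h 1 by rewrite /h /= scale1r subrK.
apply=> //.
- by move=> x x01; have [] := hd x (subset_itv_oo_cc x01).
- move=> x x01; have /hd xh := subset_itv_oo_cc x01.
  rewrite derive1E derive_val; apply/g0/pos_orthant_segment => //.
  by have := subset_itv_oo_cc x01; rewrite inE.
- by apply: derivable_within_continuous => x /hd[].
- by rewrite in_itv/= lexx ler01.
- by rewrite in_itv/= lexx ler01.
Qed.

(** * Euler's identity for [f] and for its first partial derivatives *)

(** Both sides are the derivative at l = 1 of g (l a): one by the chain rule, the other from the
    power law. *)
Lemma euler_derive (R : realType) (n : nat) (g : 'rV[R]_n -> R) (k : R)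
    (a : 'rV[R]_n) : differentiable g a ->
  (forall l, 0 < l -> g (l *: a) = l `^ k * g a) -> 'D_a g a = k * g a.
Proof.
move=> dg hg.
have d1 : is_derive (1 : R) (1 : R) (g \o (fun s : R => s *: a + 0)) ('D_a g a).
  rewrite -[X in 'D_a g X](_ : 1 *: a + 0 = a); last by rewrite scale1r addr0.
  apply: is_derive_comp_differentiable; first exact: is_derive_line.
  by rewrite scale1r addr0.
have d2 : is_derive (1 : R) (1 : R) (fun l => l `^ k * g a) (k * g a).
  have ? := is_derive1_powR k (@ltr01 R).
  apply: is_derive_eq; rewrite scaler0 add0r powR1 mulr1 /GRing.scale /= mulrC.
  by [].
rewrite -(@derive_val _ _ _ _ _ _ _ d1) -[RHS](@derive_val _ _ _ _ _ _ _ d2).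
apply: near_eq_derive; near=> l; rewrite /= addr0 hg//.
by near: l; exact: lt_nbhsr.
Unshelve. all: by end_near. Qed.

Lemma pos_orthantW (R : realType) (n : nat) (a : 'rV[R]_n) :
  pos_orthant a -> nonneg_orthant a.
Proof. by move=> a0 i; exact: ltW. Qed.

Lemma pos_orthantZ (R : realType) (n : nat) (l : R) (a : 'rV[R]_n) :
  0 < l -> pos_orthant a -> pos_orthant (l *: a).
Proof. by move=> l0 a0 i; rewrite mxE mulr_gt0. Qed.

Lemma pos_orthantD (R : realType) (n : nat) (a w : 'rV[R]_n) :
  pos_orthant a -> nonneg_orthant w -> pos_orthant (a + w).
Proof. by move=> a0 w0 i; rewrite mxE ltr_wpDr. Qed.

Lemma pos_orthant_shift1 (R : realType) (n : nat) (e : R) (z : 'rV[R]_n) :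
  0 < e -> nonneg_orthant z -> pos_orthant (e *: const_mx 1 + z).
Proof. by move=> e0 z0 i; rewrite !mxE mulr1 ltr_wpDr. Qed.

Lemma is_derive_coord (R : realType) (n : nat) (a v : 'rV[R]_n) (i : 'I_n) :
  is_derive a v (fun p : 'rV[R]_n => p ord0 i) (v ord0 i).
Proof.
have dc : derivable (fun p : 'rV[R]_n => p ord0 i) a v.
  exact/diff_derivable/differentiable_coord.
apply: DeriveDef => //.
have did : derivable (@id 'rV[R]_n) a v by exact: derivable_id.
by have := derive_mx did; rewrite derive_id => /rowP/(_ i); rewrite mxE => ->.
Qed.

(** Differentiating f (l p) = l^k f p in [p] at [a] produces an inner factor l on the left; dividing
    by it lowers the degree by one. *)
Lemma derive_homogeneous (R : realType) (n : nat) (f : 'rV[R]_n -> R) (k : R)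
    (a v : 'rV[R]_n) (l : R) :
  C2_on_pos_orthant f -> homogeneous f k -> pos_orthant a -> 0 < l ->
  'D_v f (l *: a) = l `^ (k - 1) * 'D_v f a.
Proof.
move=> C2 hom a0 l0.
have fa := (C2 _ a0).1; have fla := (C2 _ (pos_orthantZ l0 a0)).1.
have E : 'D_v (f \o *:%R l) a = l `^ k * 'D_v f a.
  rewrite -[RHS]/(l `^ k *: _) -deriveZ; last exact: diff_derivable.
  apply: near_eq_derive; near=> p; rewrite /= hom//.
  by apply: pos_orthantW; near: p; exact: near_pos_orthant.
have dl : differentiable ( *:%R l : 'rV[R]_n -> 'rV[R]_n) a by [].
rewrite deriveE in E; last exact: differentiable_comp.
rewrite diff_comp//= diff_val linearZ/= -deriveE// in E.
have -> : l `^ (k - 1) = l `^ k / l.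
  by rewrite powRB ?(gt_eqF l0) ?implybT// powRr1 ?ltW.
rewrite mulrAC -E.
by rewrite /GRing.scale/= [l * _]mulrC mulfK// gt_eqF.
Unshelve. all: by end_near. Qed.

Lemma euler_partial2_row (R : realType) (n : nat) (f : 'rV[R]_n -> R) (k : R)
    (a : 'rV[R]_n) (i : 'I_n) :
  C2_on_pos_orthant f -> homogeneous f k -> pos_orthant a ->
  \sum_j a ord0 j * partial2 f i j a = (k - 1) * 'D_(ev i) f a.
Proof.
move=> C2 hom a0; have Dfa := ((C2 _ a0).2 i).1.
rewrite -(@euler_derive _ _ ('D_(ev i) f) (k - 1) a)//.
  by rewrite derive_row_sum.
by move=> l l0; exact: derive_homogeneous.
Qed.

(* Summing over the first index differentiates Euler's identity for [f], while
[euler_partial2_row] is Euler's identity for ['D_(ev i) f]; having both avoids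
the symmetry of second derivatives. *)
Lemma euler_partial2_col (R : realType) (n : nat) (f : 'rV[R]_n -> R) (k : R)
    (a : 'rV[R]_n) (j : 'I_n) :
  C2_on_pos_orthant f -> homogeneous f k -> pos_orthant a ->
  \sum_i a ord0 i * partial2 f i j a = (k - 1) * 'D_(ev j) f a.
Proof.
move=> C2 hom a0.
pose g i (p : 'rV[R]_n) := p ord0 i * 'D_(ev i) f p.
have dg i : is_derive a (ev j) (g i)
    (a ord0 i * partial2 f i j a + 'D_(ev i) f a * ev j ord0 i).
  have ? := @is_derive_coord _ _ a (ev j) i.
  have ? := derivableP (@diff_derivable _ _ _ _ _ (ev j) ((C2 _ a0).2 i).1).
  exact: is_deriveM.
have E : 'D_(ev j) (\sum_i g i) a = k * 'D_(ev j) f a.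
  rewrite -[RHS]/(k *: _) -deriveZ; last exact/diff_derivable/(C2 _ a0).1.
  apply: near_eq_derive; near=> p.
  have p0 : pos_orthant p by near: p; exact: near_pos_orthant.
  have eulerp : 'D_p f p = k * f p.
    apply: euler_derive; first exact: (C2 _ p0).1.
    by move=> l l0; rewrite hom//; exact: pos_orthantW.
  transitivity ('D_p f p); last by rewrite eulerp.
  by rewrite fct_sumE derive_row_sum//; exact: (C2 _ p0).1.
(* The product rule leaves, besides the wanted sum, a Kronecker delta sum that collapses to
   ['D_(ev j) f a]; this term turns k into k - 1. *)
rewrite mulrBl mul1r -E (@derive_val _ _ _ _ _ _ _ (is_derive_sum dg)).
rewrite big_split/=.
have -> : \sum_i 'D_(ev i) f a * ev j ord0 i = 'D_(ev j) f a.
  rewrite (bigD1 j)//= big1 ?addr0 => [|i ij].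
    by rewrite [ev j ord0 j]mxE !eqxx mulr1.
  by rewrite [ev j ord0 i]mxE (negbTE ij) andbF mulr0.
by rewrite addrK.
Unshelve. all: by end_near. Qed.

(** * From supermodularity to nonnegative first derivatives *)

(** The derivative of p |-> f (p + w) - f p along a - b is a combination of the differences D_j f (p
    + w) - D_j f p with weights a_j - b_j >= 0. The weight at j = i is zero, and for the other j the
    difference is nonnegative because w points along [ev i] and the mixed partials are
    nonnegative. *)
Lemma increasing_differences (R : realType) (n : nat) (f : 'rV[R]_n -> R)
    (a b : 'rV[R]_n) (i : 'I_n) (h : R) :
  C2_on_pos_orthant f -> supermodular_C2 f ->
  pos_orthant b -> nonneg_orthant (a - b) -> a ord0 i = b ord0 i -> 0 <= h ->
  f (b + h *: ev i) - f b <= f (a + h *: ev i) - f a.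
Proof.
move=> C2 sm b0 ab abi h0; set w := h *: ev i.
have a0 : pos_orthant a by rewrite -[a](subrKC b); exact: pos_orthantD.
have w0 : nonneg_orthant w by move=> j; rewrite !mxE mulr_ge0 ?ler0n.
have dfw p : pos_orthant p -> differentiable (f \o (fun q => q + w)) p.
  move=> p0; apply: differentiable_comp => //.
  exact: (C2 _ (pos_orthantD p0 w0)).1.
have Dfw p v : 'D_v (f \o (fun q => q + w)) p = 'D_v f (p + w).
  rewrite /derive (_ : _ \o shift p = f \o shift (p + w))//.
  by apply/funext => s /=; rewrite addrA.
pose g := (f \o (fun q => q + w)) - f.
suff : g b <= g a by [].
apply: ge0_derive_le => // p p0.
  by apply: differentiableB; [exact: dfw|exact: (C2 _ p0).1].
have pw0 := pos_orthantD p0 w0.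
rewrite deriveB; last 2 first.
  exact/diff_derivable/dfw.
  exact/diff_derivable/(C2 _ p0).1.
rewrite Dfw !derive_row_sum; [|exact: (C2 _ p0).1|exact: (C2 _ pw0).1].
rewrite -sumrB sumr_ge0// => j _; rewrite -scalerBr.
have [->|ji] := eqVneq j i; first by rewrite !mxE abi subrr scale0r.
apply: mulr_ge0; rewrite ?ab// subr_ge0.
apply: (@ge0_derive_le _ _ ('D_(ev j) f)) => // q q0.
  exact: ((C2 _ q0).2 j).1.
have Dq := ((C2 _ q0).2 j).1.
by rewrite addrAC subrr add0r deriveE// linearZ/= -deriveE// mulr_ge0// sm.
Qed.

(** Continuity of [f] is known only relative to the closed orthant, so limits at boundary points are
    taken along families that stay inside it. *)
Lemma cvg_within_comp (S : Type) (T U : topologicalType) (A : set T)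
    (f : T -> U) (x : T) (F : set_system S) (g : S -> T) :
  Filter F -> {within A, continuous f} -> A x ->
  g s @[s --> F] --> x -> (\forall s \near F, A (g s)) ->
  f (g s) @[s --> F] --> f x.
Proof.
move=> FF /subspace_continuousP cf Ax gx Ag.
apply: (@cvg_comp _ _ _ g f F (within A (nbhs x))); last exact: cf.
move=> B /gx/= gB; rewrite /nbhs/=.
have : \forall s \near F, A (g s) /\ (A (g s) -> B (g s)) by apply: filterI.
by apply: filterS => s [? ]; exact.
Qed.

Lemma cvg_line_right (R : realType) (V : normedModType R) (x v : V) :
  s *: v + x @[s --> 0^'+] --> x.
Proof.
rewrite -[X in _ --> X](_ : 0 *: v + x = x); last by rewrite scale0r add0r.
apply: cvg_at_right_filter.
by apply: cvgD; [apply: cvgZr_tmp; exact: cvg_id|exact: cvg_cst].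
Qed.

Lemma derive_ev_ge0 (R : realType) (n : nat) (f : 'rV[R]_n -> R) (k : R)
    (a : 'rV[R]_n) (i : 'I_n) :
  (forall a, nonneg_orthant a -> 0 <= f a) ->
  {within nonneg_orthant, continuous f} ->
  C2_on_pos_orthant f -> supermodular_C2 f -> homogeneous f k -> 0 <= k ->
  pos_orthant a -> 0 <= 'D_(ev i) f a.
Proof.
move=> f0 cf C2 sm hom k0 a0.
have ei0 (l : R) : 0 <= l -> nonneg_orthant (l *: ev i : 'rV[R]_n).
  by move=> l0 j; rewrite !mxE mulr_ge0 ?ler0n.
have inc (h : R) : 0 < h -> f a <= f (a + h *: ev i).
  (* [q] is the projection of [a] onto the i-th axis. The points [b s] lie in the open orthant for 0
     < s <= 1, tend to [q] as s tends to 0, and keep the i-th coordinate of [a]. *)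
  move=> h0; pose q : 'rV[R]_n := a ord0 i *: ev i.
  pose b s := s *: (a - q) + q.
  have aq0 : nonneg_orthant (a - q).
    move=> j; rewrite !mxE; have [->|_] := eqVneq j i.
      by rewrite mulr1 subrr.
    by rewrite mulr0 subr0 ltW.
  have b0 s : 0 < s <= 1 -> pos_orthant (b s).
    move=> /andP[s0 s1] j; rewrite !mxE; have [->|_] := eqVneq j i.
      by rewrite mulr1 subrr mulr0 add0r.
    by rewrite mulr0 subr0 addr0 mulr_gt0.
  have q0 : nonneg_orthant q by apply: ei0; exact: ltW.
  have qh : q + h *: ev i = (a ord0 i + h) *: ev i by rewrite -scalerDl.
  have s1 : \forall s \near (0 : R)^'+, 0 < s <= 1.
    near=> s; apply/andP; split; near: s.
      exact: nbhs_right_gt.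
    exact: nbhs_right_le.
  have cb : f (b s) @[s --> 0^'+] --> f q.
    apply: (@cvg_within_comp _ _ _ _ _ _ _ b _ cf) => //.
      exact: cvg_line_right.
    by apply: filterS s1 => s /b0/pos_orthantW.
  have cbh : f (b s + h *: ev i) @[s --> 0^'+] --> f (q + h *: ev i).
    apply: (@cvg_within_comp _ _ _ _ _ _ _ (fun s => b s + h *: ev i) _ cf).
    - by rewrite qh; apply: ei0; rewrite addr_ge0// ltW.
    - by apply: cvgD; [exact: cvg_line_right|exact: cvg_cst].
    - apply: filterS s1 => s /b0 bs0; apply/pos_orthantW/pos_orthantD => //.
      by apply: ei0; exact: ltW.
  (* On the axis, f (l e_i) = l^k f (e_i) with f (e_i) >= 0 and k >= 0, so [f] is nondecreasing
     there. *)
  have qqh : f q <= f (q + h *: ev i).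
    rewrite qh /q.
    have e0 : nonneg_orthant (ev i : 'rV[R]_n).
      by rewrite -[ev i]scale1r; exact: ei0.
    have ah0 : 0 < a ord0 i + h by rewrite addr_gt0.
    rewrite !hom// ler_wpM2r ?f0// ge0_ler_powR// ?nnegrE ?(ltW ah0)//.
      exact: ltW.
    by rewrite lerDl ltW.
  (* The increment at [a] dominates the one at each [b s], hence also their limit, the increment at
     [q]. *)
  rewrite -subr_ge0; apply: (@le_trans _ _ (f (q + h *: ev i) - f q)).
    by rewrite subr_ge0.
  apply: cvgr_to_le (cvgB cbh cb) _.
  apply: filterS s1 => s s01; apply: increasing_differences => //.
  - exact: b0.
  - move=> j; have := aq0 j; rewrite !mxE; move: s01 => /andP[].
    move: (a ord0 j) (a ord0 i * _) => u v; nra.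
  - by rewrite !mxE !eqxx mulr1 subrr mulr0 add0r.
  - exact: ltW.
have dfa : derivable f a (ev i) by exact/diff_derivable/(C2 _ a0).1.
(* Only increments with h > 0 are controlled; since the derivative exists, its right-hand limit
   suffices. *)
rewrite /derive cvg_at_rightE//; apply: limr_ge.
  by move: dfa => /cvg_ex[l /cvg_dnbhs_at_right/cvgP].
near=> h; have h0 : 0 < h by near: h; exact: nbhs_right_gt.
by rewrite /= mulr_ge0 ?invr_ge0 ?(ltW h0)// subr_ge0 addrC inc.
Unshelve. all: by end_near. Qed.

(** * Concavity of z |-> f (z^2) on the open orthant *)

(** The bound 4 u_i u_j <= 2 u_i^2 + 2 u_j^2 is weighted by a_i a_j P_ij; on the diagonal it is an
    equality, whatever the sign of P_ii. The two resulting double sums are evaluated by the row and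
    column identities as (k - 1) S each, where S = \sum_i 2 u_i^2 a_i D_i. The total is (2 k - 1) S
    <= 0. *)
Lemma quadratic_form_le0 (R : realType) (n : nat) (a u D : 'I_n -> R)
    (P : 'I_n -> 'I_n -> R) (k : R) :
  k <= 1 / 2 -> (forall i, 0 <= a i) -> (forall i, 0 <= D i) ->
  (forall i j, i != j -> 0 <= P i j) ->
  (forall i, \sum_j a j * P i j = (k - 1) * D i) ->
  (forall j, \sum_i a i * P i j = (k - 1) * D j) ->
  \sum_i (2 * u i ^+ 2 * a i * D i +
    \sum_j 4 * (u i * u j) * (a i * a j * P i j)) <= 0.
Proof.
move=> k2 a0 D0 P0 row col.
have amgm i j : 4 * (u i * u j) * (a i * a j * P i j) <=
    2 * u i ^+ 2 * a i * (a j * P i j) + 2 * u j ^+ 2 * a j * (a i * P i j).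
  have [->|ij] := eqVneq i j.
    by rewrite -subr_ge0 [leRHS](_ : _ = 0)//; ring.
  rewrite -subr_ge0 [leRHS](_ : _ = 2 * (u i - u j) ^+ 2 * (a i * a j * P i j)).
    apply: mulr_ge0; first by rewrite mulr_ge0 ?sqr_ge0.
    by rewrite mulr_ge0 ?P0 // mulr_ge0.
  by ring.
pose S := \sum_i 2 * u i ^+ 2 * a i * D i.
have S0 : 0 <= S.
  apply: sumr_ge0 => i _; do 2 apply: mulr_ge0 => //.
  by rewrite mulr_ge0 ?sqr_ge0.
have rows : \sum_i \sum_j 2 * u i ^+ 2 * a i * (a j * P i j) = (k - 1) * S.
  rewrite mulr_sumr; apply: eq_bigr => i _.
  by rewrite -mulr_sumr row mulrCA.
have cols : \sum_i \sum_j 2 * u j ^+ 2 * a j * (a i * P i j) = (k - 1) * S.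
  rewrite exchange_big mulr_sumr; apply: eq_bigr => i _ /=.
  by rewrite -mulr_sumr col mulrCA.
apply: (@le_trans _ _ (S + (k - 1) * S + (k - 1) * S)); last by nra.
rewrite -{1}rows -cols -addrA -!big_split/=; apply: ler_sum => i _.
by rewrite lerD2l -big_split/=; apply: ler_sum => j _; exact: amgm.
Qed.

Definition squares (R : realType) (n : nat) (z : 'rV[R]_n) : 'rV[R]_n :=
  \row_i z ord0 i ^+ 2.

Lemma concave_squares_pos (R : realType) (n : nat) (f : 'rV[R]_n -> R) (k : R)
    (x y : 'rV[R]_n) (t : R) :
  C2_on_pos_orthant f -> supermodular_C2 f -> homogeneous f k -> k <= 1 / 2 ->
  (forall a i, pos_orthant a -> 0 <= 'D_(ev i) f a) ->
  pos_orthant x -> pos_orthant y -> 0 <= t <= 1 ->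
  t * f (squares x) + (1 - t) * f (squares y) <=
  f (squares (t *: x + (1 - t) *: y)).
Proof.
move=> C2 sm hom k2 D0 x0 y0 /andP[t0 t1].
pose w i (s : R) : R := s * (y - x) ord0 i + x ord0 i.
pose c s : 'rV[R]_n := \row_i w i s ^+ 2.
(* The sign is reversed because the second-derivative criterion applied below is one for
   convexity. *)
pose h s := - f (c s).
have w0 (s : R) i : s \in `[0, 1] -> 0 < w i s.
  rewrite in_itv/= => s01; have := pos_orthant_segment x0 y0 s01 i.
  by rewrite /w !mxE.
have c0 (s : R) : s \in `[0, 1] -> pos_orthant (c s).
  by move=> s01 i; rewrite mxE exprn_gt0// w0.
have dw i (s : R) : is_derive s (1 : R) (w i) ((y - x) ord0 i).
  exact: (@is_derive_line R R (x ord0 i) ((y - x) ord0 i) s).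
have dc (s : R) : is_derive s (1 : R) c (\row_i (2 * w i s * (y - x) ord0 i)).
  apply: (@is_derive_row _ _ (fun i s => w i s ^+ 2)
    (fun i s => 2 * w i s * (y - x) ord0 i)).
  move=> i; exact: (@is_deriveX _ _ _ 2 s 1 _ (dw i s)).
pose Dh s := - \sum_i 2 * w i s * (y - x) ord0 i * 'D_(ev i) f (c s).
(* Used with F = f for the first derivative of [h], and with each F = ['D_(ev i) f] for the
   second. *)
have dcomp (F : 'rV[R]_n -> R) (s : R) : differentiable F (c s) ->
    is_derive s (1 : R) (F \o c)
      (\sum_i 2 * w i s * (y - x) ord0 i * 'D_(ev i) F (c s)).
  move=> dF; have := is_derive_comp_differentiable (dc s) dF.
  rewrite derive_row_sum//; under eq_bigr do rewrite mxE.
  exact.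
have dh (s : R) : s \in `[0, 1] -> is_derive s (1 : R) h (Dh s).
  move=> /c0 cs0; apply: (is_deriveN (dcomp f s _)).
  exact: (C2 _ cs0).1.
pose DDh s := - \sum_i (2 * w i s * (y - x) ord0 i *
    (\sum_j 2 * w j s * (y - x) ord0 j * partial2 f i j (c s)) +
    'D_(ev i) f (c s) * (2 * (y - x) ord0 i ^+ 2)).
have dDh (s : R) : s \in `[0, 1] -> is_derive s (1 : R) Dh (DDh s).
  move=> /c0 cs0.
  have dt i : is_derive s (1 : R)
    (fun s => 2 * w i s * (y - x) ord0 i * 'D_(ev i) f (c s))
    (2 * w i s * (y - x) ord0 i *
    (\sum_j 2 * w j s * (y - x) ord0 j * partial2 f i j (c s)) +
    'D_(ev i) f (c s) * (2 * (y - x) ord0 i ^+ 2)).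
    have d1 := dcomp ('D_(ev i) f) s ((C2 _ cs0).2 i).1.
    have d2 : is_derive s (1 : R) (fun s => 2 * w i s * (y - x) ord0 i)
        (2 * (y - x) ord0 i ^+ 2).
      have ? := dw i s.
      apply: is_derive_eq.
      rewrite /GRing.scale/=; ring.
    exact: (is_deriveM d2 d1).
  have := is_deriveN (is_derive_sum dt).
  by congr (is_derive _ _ _ _); apply/funext => r; rewrite /Dh !fctE fct_sumE.
have DDh0 s : s \in `[0, 1] -> 0 <= DDh s.
  move=> s01; have cs0 := c0 _ s01; rewrite oppr_ge0.
  (* With a_i = w_i^2 and u_i = v_i / w_i, where v = y - x and w_i > 0, one has 2 w_i v_i = 2 u_i
     a_i and v_i^2 = u_i^2 a_i, which puts the second derivative in the form of the lemma. *)
  have := @quadratic_form_le0 _ _ (fun i => c s ord0 i)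
    (fun i => (y - x) ord0 i / w i s) (fun i => 'D_(ev i) f (c s))
    (fun i j => partial2 f i j (c s)) k k2.
  move=> /(_ (pos_orthantW cs0) (fun i => D0 _ i cs0)).
  move=> /(_ (fun i j ij => sm _ cs0 i j ij)).
  move=> /(_ (fun i => euler_partial2_row i C2 hom cs0)).
  move=> /(_ (fun j => euler_partial2_col j C2 hom cs0)).
  have cE i : c s ord0 i = w i s ^+ 2 by rewrite mxE.
  apply: le_trans; rewrite le_eqVlt; apply/orP; left; apply/eqP.
  apply: eq_bigr => i _; have wi := w0 _ i s01.
  rewrite addrC mulr_sumr; congr (_ + _).
    rewrite cE; field; exact: lt0r_neq0.
  apply: eq_bigr => j _; have wj := w0 _ j s01.
  rewrite !cE; field; rewrite !lt0r_neq0//.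
(* [Dh] is known to be the derivative of [h] only on [0, 1]; near an interior point the two agree,
   which is enough to differentiate again. *)
have D1h (s : R) : s \in `]0, 1[ -> \forall r \near s, Dh r = 'D_1 h r.
  move=> s01; near=> r; apply/esym/derive_val/dh/subset_itv_oo_cc.
  by near: r; exact: near_in_itvoo.
have h_at (s : R) : s \in `[0, 1] -> h r @[r --> s] --> h s.
  move=> s01; apply: differentiable_continuous.
  by apply/derivable1_diffP; case: (dh s s01).
have i0 : (0 : R) \in `[0, 1] by rewrite in_itv/= lexx ler01.
have i1 : (1 : R) \in `[0, 1] by rewrite in_itv/= lexx ler01.
have DDh_ge0 (s : R) : 0 < s < 1 -> 0 <= 'D_1 ('D_1 h) s.
  move=> s01; have s_oo : s \in `]0, 1[ by rewrite in_itv.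
  have s_cc := subset_itv_oo_cc s_oo.
  rewrite -(@near_eq_derive _ _ _ _ _ s (1 : R) (D1h _ s_oo)).
  by have [_ ->] := dDh _ s_cc; exact: DDh0.
have dvh : {in `]0, 1[, forall s : R, derivable h s 1}.
  by move=> s /subset_itv_oo_cc/dh[].
have dvDh : {in `]0, 1[, forall s : R, derivable ('D_1 h) s 1}.
  move=> s s01; apply: (near_eq_derivable (D1h _ s01)).
  by case: (dDh _ (subset_itv_oo_cc s01)).
have := second_derivative_convex DDh_ge0 (cvg_at_left_filter (h_at _ i1))
  (cvg_at_right_filter (h_at _ i0)) dvh dvDh (Itv01 t0 t1) ler01.
rewrite !convRE /= /unstable.onem mulr0 mulr1 add0r.
have c_0 : c 0 = squares x.
  by apply/rowP => i; rewrite !mxE /w mul0r add0r.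
have c_1 : c 1 = squares y.
  by apply/rowP => i; rewrite !mxE /w mul1r !mxE subrK.
(* The path starts at [x] and ends at [y], so weight t on [x] corresponds to time 1 - t. *)
have c_t : c (1 - t) = squares (t *: x + (1 - t) *: y).
  by apply/rowP => i; rewrite !mxE /w !mxE; congr (_ ^+ 2); ring.
by rewrite /h c_0 c_1 c_t !mulrN -opprD lerN2.
Unshelve. all: by end_near. Qed.

(** * Extension of concavity to the closed orthant *)

Lemma cvg_row (R : realType) (n : nat) (T : Type) (F : set_system T)
    (c : 'I_n -> T -> R) (l : 'I_n -> R) : Filter F ->
  (forall i, c i s @[s --> F] --> l i) ->
  \row_i c i s @[s --> F] --> \row_i l i.
Proof.
move=> FF cl A [P nP sPA].
have : \forall s \near F, forall i, P ord0 i (c i s).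
  apply: (@filter_forall _ _ (fun i s => P ord0 i (c i s)) F _) => i.
  by apply: cl; have := nP ord0 i; rewrite mxE.
apply: filterS => s Ps; apply: sPA => i j /=.
by rewrite mxE (ord1 i).
Qed.

Lemma squares_continuous (R : realType) (n : nat) :
  continuous (@squares R n).
Proof.
move=> z.
apply: (@cvg_row _ _ _ (nbhs z) (fun i (y : 'rV[R]_n) => y ord0 i ^+ 2)
  (fun i => z ord0 i ^+ 2) (nbhs_filter z)) => i.
by apply: cvgM; exact: coord_continuous.
Qed.

Lemma nonneg_squares (R : realType) (n : nat) (z : 'rV[R]_n) :
  nonneg_orthant (squares z).
Proof. by move=> i; rewrite mxE sqr_ge0. Qed.

Lemma concave_squared_obj (R : realType) (n : nat) (f : 'rV[R]_n -> R) (k : R) :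
  {within nonneg_orthant, continuous f} ->
  C2_on_pos_orthant f -> supermodular_C2 f -> homogeneous f k -> k <= 1 / 2 ->
  (forall a i, pos_orthant a -> 0 <= 'D_(ev i) f a) ->
  concave_on nonneg_orthant (squared_obj f).
Proof.
move=> cf C2 sm hom k2 D0 x y t x0 y0 t01.
(* Adding e (1, ..., 1) moves a boundary point into the open orthant. This shift commutes with
   convex combinations since the weights add up to 1. *)
pose s1 (e : R) (z : 'rV[R]_n) : 'rV[R]_n := e *: const_mx 1 + z.
have cvgs z : f (squares (s1 e z)) @[e --> 0^'+] --> f (squares z).
  apply: (@cvg_within_comp _ _ _ _ _ _ _ (fun e => squares (s1 e z)) _ cf).
  - exact: nonneg_squares.
  - apply: (@cvg_comp _ _ _ (fun e => s1 e z) (@squares R n)).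
      exact: cvg_line_right.
    exact: squares_continuous.
  - by apply: nearW => e; exact: nonneg_squares.
have fconc : t * f (squares x) + (1 - t) * f (squares y) <=
    f (squares (t *: x + (1 - t) *: y)).
  have lhs : t * f (squares (s1 e x)) + (1 - t) * f (squares (s1 e y))
      @[e --> 0^'+] --> t * f (squares x) + (1 - t) * f (squares y).
    by apply: cvgD; apply: cvgM (cvgs _); exact: cvg_cst.
  apply: (ler_cvg_to lhs (cvgs _)); near=> e.
  have e0 : 0 < e by near: e; exact: nbhs_right_gt.
  have -> : s1 e (t *: x + (1 - t) *: y) = t *: s1 e x + (1 - t) *: s1 e y.
    by apply/rowP => i; rewrite !mxE; ring.
  by apply: (concave_squares_pos C2 sm hom k2) => //; exact: pos_orthant_shift1.
have sumE : \sum_i (t *: x + (1 - t) *: y) ord0 i =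
    t * (\sum_i x ord0 i) + (1 - t) * (\sum_i y ord0 i).
  by rewrite !mulr_sumr -big_split/=; apply: eq_bigr => i _; rewrite !mxE.
rewrite /squared_obj sumE -!/(squares _); move: fconc t01 => + /andP[].
move: (\sum_i x ord0 i) (\sum_i y ord0 i) => X Y.
(* Convexity of the square, applied to the coordinate sums; the gap is exactly t (1 - t) (X -
   Y)^2. *)
have tXY (tt : R) : 0 <= tt -> tt <= 1 ->
    (tt * X + (1 - tt) * Y) ^+ 2 <= tt * X ^+ 2 + (1 - tt) * Y ^+ 2.
  move=> tt0 tt1; rewrite -subr_ge0.
  rewrite [leRHS](_ : _ = tt * (1 - tt) * (X - Y) ^+ 2); last by ring.
  by apply: mulr_ge0 (sqr_ge0 _); rewrite mulr_ge0// subr_ge0.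
move=> fc t0 t1; have := tXY t t0 t1; move: fc.
move: (f _) (f _) (f _) => A B C; nra.
Unshelve. all: by end_near. Qed.

(** * Monotonicity of [f], and the case of negative degree *)

Lemma le_pos_orthant (R : realType) (n : nat) (f : 'rV[R]_n -> R)
    (a b : 'rV[R]_n) :
  C2_on_pos_orthant f ->
  (forall a i, pos_orthant a -> 0 <= 'D_(ev i) f a) ->
  pos_orthant a -> nonneg_orthant (b - a) -> f a <= f b.
Proof.
move=> C2 D0 a0 ba0.
have b0 : pos_orthant b by rewrite -[b](subrKC a); exact: pos_orthantD.
apply: ge0_derive_le => // p p0; first exact: (C2 _ p0).1.
rewrite derive_row_sum; last exact: (C2 _ p0).1.
by apply: sumr_ge0 => i _; apply: mulr_ge0; [exact: ba0|exact: D0].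
Qed.

(** Shifting both points by the same e (1, ..., 1) preserves b - a and reaches the open orthant; the
    inequality survives as e tends to 0. *)
Lemma le_nonneg_orthant (R : realType) (n : nat) (f : 'rV[R]_n -> R)
    (a b : 'rV[R]_n) :
  {within nonneg_orthant, continuous f} ->
  C2_on_pos_orthant f ->
  (forall a i, pos_orthant a -> 0 <= 'D_(ev i) f a) ->
  nonneg_orthant a -> nonneg_orthant (b - a) -> f a <= f b.
Proof.
move=> cf C2 D0 a0 ba0.
have b0 : nonneg_orthant b.
  by move=> i; have := ba0 i; have := a0 i; rewrite !mxE; lra.
pose s1 (e : R) (z : 'rV[R]_n) : 'rV[R]_n := e *: const_mx 1 + z.
have cvgs z : nonneg_orthant z -> f (s1 e z) @[e --> 0^'+] --> f z.
  move=> z0.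
  apply: (@cvg_within_comp _ _ _ _ _ _ _ (fun e => s1 e z) _ cf) => //.
    exact: cvg_line_right.
  near=> e; have e0 : 0 < e by near: e; exact: nbhs_right_gt.
  exact/pos_orthantW/pos_orthant_shift1.
apply: (ler_cvg_to (cvgs _ a0) (cvgs _ b0)); near=> e.
have e0 : 0 < e by near: e; exact: nbhs_right_gt.
apply: le_pos_orthant => //; first exact: pos_orthant_shift1.
by move=> i; have := ba0 i; rewrite !mxE opprD addrACA subrr add0r.
Unshelve. all: by end_near. Qed.

(** For s > 0 the product s^(-k) f (s a) is constantly f a. As s tends to 0, its first factor tends
    to 0 and its second to f 0, so the constant is 0. *)
Lemma homogeneous_neg_eq0 (R : realType) (n : nat) (f : 'rV[R]_n -> R) (k : R)
    (a : 'rV[R]_n) :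
  {within nonneg_orthant, continuous f} -> homogeneous f k -> k < 0 ->
  nonneg_orthant a -> f a = 0.
Proof.
move=> cf hom k0 a0.
have z0 : nonneg_orthant (0 : 'rV[R]_n) by move=> i; rewrite mxE.
have cvgf : f (s *: a + 0) @[s --> 0^'+] --> f 0.
  apply: (@cvg_within_comp _ _ _ _ _ _ _ (fun s => s *: a + 0) _ cf) => //.
    exact: cvg_line_right.
  near=> s; have s0 : 0 < s by near: s; exact: nbhs_right_gt.
  by move=> i; rewrite !mxE addr0 mulr_ge0// ltW.
have cvgp : s `^ (- k) * f (s *: a + 0) @[s --> 0^'+] --> 0 * f 0.
  by apply: cvgM cvgf; apply: powR_cvg0; rewrite oppr_gt0.
rewrite mul0r in cvgp.
have cvga : s `^ (- k) * f (s *: a + 0) @[s --> (0 : R)^'+] --> f a.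
  apply: cvg_near_cst; near=> s.
  have s0 : 0 < s by near: s; exact: nbhs_right_gt.
  by rewrite addr0 hom// powRN mulKf// powR_eq0 gt_eqF.
exact: (cvg_unique _ cvga cvgp).
Unshelve. all: by end_near. Qed.

(** * Existence of a maximiser *)

(** Continuity holds on the whole space because [squares] maps every point into the closed
    orthant. *)
Lemma squared_obj_continuous (R : realType) (n : nat) (f : 'rV[R]_n -> R) :
  {within nonneg_orthant, continuous f} -> continuous (squared_obj f).
Proof.
move=> cf z.
have cfz : f (squares y) @[y --> z] --> f (squares z).
  apply: (@cvg_within_comp _ _ _ _ _ _ _ (@squares R n) (nbhs_filter z) cf).
  - exact: nonneg_squares.
  - exact: squares_continuous.
  - by apply: nearW => y; exact: nonneg_squares.
have cs : continuous (fun y : 'rV[R]_n => \sum_i y ord0 i).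
  apply: continuous_big => [|i _]; first exact: add_continuous.
  exact: coord_continuous.
by apply: cvgB cfz _; apply: cvgM; exact: cs.
Qed.

Lemma squared_obj_le0 (R : realType) (n : nat) (f : 'rV[R]_n -> R) (k : R)
    (z : 'rV[R]_n) :
  (forall a, nonneg_orthant a -> 0 <= f a) ->
  (forall a b, nonneg_orthant a -> nonneg_orthant (b - a) -> f a <= f b) ->
  homogeneous f k -> k <= 1 / 2 -> nonneg_orthant z ->
  1 <= \sum_i z ord0 i -> f (const_mx 1) <= \sum_i z ord0 i ->
  squared_obj f z <= 0.
Proof.
move=> f0 fle hom k2 z0; set T := \sum_i _ => T1 FT.
have T0 : 0 < T by exact: lt_le_trans T1.
have one0 : nonneg_orthant (const_mx 1 : 'rV[R]_n) by move=> i; rewrite mxE.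
have zT i : z ord0 i <= T.
  by rewrite /T (bigD1 i)//= lerDl sumr_ge0.
rewrite subr_le0; apply: (@le_trans _ _ (f (T ^+ 2 *: const_mx 1))).
  apply: fle; first exact: nonneg_squares.
  move=> i; rewrite !mxE mulr1 subr_ge0 ler_sqr ?nnegrE ?(ltW T0)//.
(* T^2 is split into two factors: (T^2)^k <= T since 2 k <= 1 <= T, and f (1, ..., 1) <= T by
   hypothesis. *)
rewrite hom ?exprn_gt0// expr2; apply: ler_pM; rewrite ?powR_ge0 ?f0//.
rewrite -expr2 -powR_mulrn ?(ltW T0)// -powRrM -[leRHS]powRr1 ?(ltW T0)//.
by apply: ler_powR => //; lra.
Qed.

Lemma ex_max_squared_obj (R : realType) (n : nat) (f : 'rV[R]_n -> R) (k : R) :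
  (forall a, nonneg_orthant a -> 0 <= f a) ->
  {within nonneg_orthant, continuous f} ->
  (forall a b, nonneg_orthant a -> nonneg_orthant (b - a) -> f a <= f b) ->
  homogeneous f k -> k <= 1 / 2 ->
  exists2 zstar, nonneg_orthant zstar &
    forall z, nonneg_orthant z -> squared_obj f z <= squared_obj f zstar.
Proof.
move=> f0 cf fle hom k2.
(* [B] meets both thresholds of [squared_obj_le0]. A point of the orthant outside the box [0, B]^n
   has a coordinate above [B], so its coordinate sum is at least [B] and its objective is at most 0,
   which is at most the value at the origin. *)
pose B := Num.max 1 (f (const_mx 1)).
have B1 : 1 <= B by rewrite le_max lexx.
have BF : f (const_mx 1) <= B by rewrite le_max lexx orbT.
pose A := [set z : 'rV[R]_n | forall i, `[0, B]%classic (z ord0 i)].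
have cA : compact A.
  apply: (@rV_compact _ _ (fun=> `[0, B]%classic)) => _.
  exact: segment_compact.
have A0 : A 0 by move=> i; rewrite /= mxE in_itv/= lexx (le_trans _ B1).
have [||c /set_mem Ac cmax] := @EVT_max_rV R n (squared_obj f) A _ cA.
- by exists 0.
- exact/continuous_subspaceT/squared_obj_continuous.
exists c => [i|z z0]; first by have := Ac i; rewrite /= in_itv => /andP[].
have [zB|zB] := pselect (A z); first exact/cmax/mem_set.
apply: (@le_trans _ _ 0).
  have /existsNP[i /= zi] := zB.
  have Bz : B <= \sum_i z ord0 i.
    rewrite (bigD1 i)//=; apply: (@le_trans _ _ (z ord0 i)).
      move/negP: zi; rewrite in_itv/= (z0 i)/= -ltNge; exact: ltW.
    by rewrite lerDl sumr_ge0.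
  by apply: (squared_obj_le0 f0 fle hom k2 z0); exact: le_trans Bz.
apply: le_trans (cmax 0 (mem_set A0)).
rewrite /squared_obj [X in _ - X ^+ 2]big1 => [|i _]; last by rewrite mxE.
by rewrite expr0n subr0 f0//; exact: nonneg_squares.
Qed.

(** * The change of variables a = z^2 and the conclusion *)

Lemma principal_objE (R : realType) (n : nat) (f : 'rV[R]_n -> R)
    (a : 'rV[R]_n) : nonneg_orthant a ->
  principal_obj f a = squared_obj f (\row_i Num.sqrt (a ord0 i)).
Proof.
move=> a0; rewrite /squared_obj; congr (f _ - _ ^+ 2).
  by apply/rowP => i; rewrite !mxE sqr_sqrtr.
by apply: eq_bigr => i _; rewrite mxE.
Qed.

Lemma principal_obj_squares (R : realType) (n : nat) (f : 'rV[R]_n -> R)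
    (z : 'rV[R]_n) : nonneg_orthant z ->
  principal_obj f (\row_i (z ord0 i) ^+ 2) = squared_obj f z.
Proof.
move=> z0; congr (_ - _ ^+ 2).
by apply: eq_bigr => i _; rewrite mxE sqrtr_sqr ger0_norm.
Qed.

Theorem mainTheorem15 (R : realType) (n : nat) (f : 'rV[R]_n -> R) (k : R) :
  (forall a, nonneg_orthant a -> 0 <= f a) ->
  {within nonneg_orthant, continuous f} ->
  C2_on_pos_orthant f ->
  supermodular_C2 f ->
  homogeneous f k ->
  k < 1 / 2 ->
  concave_on nonneg_orthant (squared_obj f) /\
  exists zstar, [/\ nonneg_orthant zstar,
    (forall z, nonneg_orthant z -> squared_obj f z <= squared_obj f zstar),
    (forall a, nonneg_orthant a -> principal_obj f a <= squared_obj f zstar) &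
    principal_obj f (\row_i (zstar ord0 i) ^+ 2) = squared_obj f zstar].
Proof.
move=> f0 cf C2 sm hom k2.
(* For [k < 0] continuity at the origin forces [f = 0], which is homogeneous of
degree 0. *)
wlog k0 : k hom k2 / 0 <= k => [main|].
  have [|kneg] := leP 0 k; first exact: main.
  apply: (main 0) => //.
  move=> l a l0 a0; rewrite !(homogeneous_neg_eq0 cf hom kneg) ?mulr0//.
  by move=> i; rewrite mxE mulr_ge0// ltW.
have {}k2 := ltW k2.
have D0 a i : pos_orthant a -> 0 <= 'D_(ev i) f a.
  exact: (derive_ev_ge0 i f0 cf C2 sm hom k0).
split; first exact: (concave_squared_obj cf C2 sm hom k2).
have fle a b := @le_nonneg_orthant _ _ _ a b cf C2 D0.
have [z z0 zmax] := ex_max_squared_obj f0 cf fle hom k2.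
exists z; split => //; last exact: principal_obj_squares.
(* Every [a] is the square of the nonnegative vector of its square roots, so the bound in z
   transfers to [a]. *)
move=> a a0; rewrite principal_objE//; apply: zmax => i.
by rewrite mxE sqrtr_ge0.
Qed.
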